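(* Let $\mathsf R$ be a locally finite operad, with associated simplicial groupoid $D_\bullet$ and incidence bialgebra $\mathbb Q_{\pi_0 D_1}$ with comultiplication $\Delta$ (extended to the completion $\mathbb Q^{\pi_0 D_1}$), and let $G\in\mathbb Q^{\pi_0 D_1}$ be its connected Green function. Then $$\Delta(G)=\sum_{w} G^w\otimes G_w/|\mathrm{Aut}(w)| ,$$ where the sum is over $w\in\pi_0 D_0$, i.e. over isomorphism classes of finite sequences of colours. (Equivalently, $\Delta(G)=\sum_w G^w\otimes g_w$ where $g_w:=G_w/|\mathrm{Aut}(w)|$.)
   Context: **Conventions.** $\mathbf{Grpd}$ is the 2-category of groupoids, $\mathbf{Grpd}/I$ the strict slice, $\mathbf{Grpd}_{/I}$ the weak slice (triangles commuting up to specified isomorphism). A polynomial of groupoids $I\xleftarrow{s}E\xrightarrow{p}B\xrightarrow{t}J$, with $p$ a fibration, defines the polynomial functor $t_!\circ p_*\circ s^*:\mathbf{Grpd}/I\to\mathbf{Grpd}/J$ ($s^*$ is pullback, $t_!$ postcomposition, $p_*$ right adjoint to $p^*$). For a groupoid-indexed family $(E_b)_{b\in B}$, the homotopy sum is $\int^{b\in B}E_b:=\sum_{b\in\pi_0B}E_b/\mathrm{Aut}(b)$, with $/$ the homotopy quotient (action groupoid). $\mathbb B$ is the groupoid of finite sets and bijections, $\mathbb B'$ the groupoid of finite pointed sets and basepoint-preserving bijections, $\underline n$ the fibre of $\mathbb B'\to\mathbb B$ over $n$. $\mathsf S:\mathbf{Grpd}\to\mathbf{Grpd}$ is the symmetric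 monoidal category monad, represented by $1\leftarrow\mathbb B'\to\mathbb B\to1$, so $\mathsf S(X)=\int^{n\in\mathbb B}\mathrm{Map}(\underline n,X)$; its unit $\eta^{\mathsf S}$ is the inclusion of singleton families and its multiplication $\mu^{\mathsf S}$ is concatenation of families. **Operads.** An operad means a coloured symmetric operad in sets; it is identified with a polynomial monad $\mathsf R$ on $\mathbf{Grpd}/I$ represented by $I\leftarrow E\to B\to I$, together with a cartesian monad map to $\mathsf S$ over $F:I\to1$ (maps $E\to\mathbb B'$, $B\to\mathbb B$ forming a pullback square with $E\to B$ and $\mathbb B'\to\mathbb B$, compatibly with the monad structures), where $I$ is a set and $B\to\mathbb B$ is a discrete fibration. Here $I$ is the set of colours, $B$ the disjoint union over $n$ of the action groupoids of the symmetric groups $\mathfrak S_n$ on the sets of $n$-ary operations, $E$ the groupoid of operations with a marked input slot, $E\to I$ gives the colour of the marked slot, $B\to I$ gives the output colour; the monad structure is operad substitution. $F_!:\mathbf{Grpd}/I\to\mathbf{Grpd}$ is the forgetful functor, and $\phi:F_!\mathsf R\Rightarrow\mathsf SF_!$ is the induced cartesian natural transformation, making $(F_!,\phi)$ a monad opfunctor. **Bar construction.** $A$ is the terminal object of $\mathbf{Grpd}/I$ and $\alpha:\mathsf RA\to A$ the unique map (terminal $\mathsf R$-algebra). Put $C_n:=F_!\mathsf R^nA$ and $D_n:=\mathsf S C_n$; thus $C_0=I$, $C_1=B$. The maps $d_k:C_{n+1}\to C_n$ ($0\le k\le n$) are $F_!\mathsf R^{n-k}\mu_{\mathsf R^{k-1}A}$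 with the convention $\mu_{\mathsf R^{-1}A}=\alpha$, and $s_k:C_n\to C_{n+1}$ are $F_!\mathsf R^{n-k}\eta_{\mathsf R^kA}$. Applying $\mathsf S$ to these and adding the top face maps $d_{n+1}:=\mu^{\mathsf S}_{C_n}\circ\mathsf S(\phi_{\mathsf R^nA}):D_{n+1}\to D_n$ gives a simplicial groupoid $D_\bullet$. In particular $d_0,d_1:D_1\to D_0=\mathsf SI$ give, respectively, output colours and (concatenated) input colours of a family of operations. **Finiteness.** A groupoid $X$ is homotopy finite if it has finitely many components and finite automorphism groups; then $|X|:=\sum_{x\in\pi_0X}1/|\mathrm{Aut}(x)|$. It is locally finite if all automorphism groups are finite; all groupoids here are assumed locally finite. A map is finite if its homotopy fibres are homotopy finite. $\mathsf R$ is locally finite when $\mu:\mathsf R\mathsf R\Rightarrow\mathsf R$ and $\eta:\mathrm{Id}\Rightarrow\mathsf R$ have all components finite maps. **Cardinality.** For a finite map $p:X\to Y$, its cardinality is $|p|:=\sum_{y\in\pi_0Y}\frac{|X_y|}{|\mathrm{Aut}(y)|}\delta_y\in\mathbb Q^{\pi_0Y}$ ($X_y$ the homotopy fibre); it lies in $\mathbb Q_{\pi_0Y}$, the vector space with basis $\{\delta_y\}$, if $X$ is homotopy finite. $\mathbb Q^{\pi_0Y}$ (infinite sums allowed) is the completion of $\mathbb Q_{\pi_0Y}$; $\delta_y\otimes\delta_{y'}=\delta_{(y,y')}$, and $\otimes$ is extended to completions. **Incidence bialgebra.** $\mathbb Q_{\pi_0D_1}$ is as an algebra the polynomial ring on $\pi_0C_1$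 (isomorphism classes of operations), the product being disjoint union of families. The comultiplication is the cardinality of the span $D_1\xleftarrow{d_1}D_2\xrightarrow{(d_2,d_0)}D_1\times D_1$, i.e. of the functor $(d_2,d_0)_!\circ d_1^*$ : $\Delta(\delta_x)$ is the cardinality of $(D_2)_x\to D_1\times D_1$, where $(D_2)_x$ is the homotopy fibre of $d_1$ over $x$; the same span extends $\Delta$ to $\mathbb Q^{\pi_0D_1}\to\mathbb Q^{\pi_0(D_1\times D_1)}$. The counit is the cardinality of the span $D_1\xleftarrow{s_0}D_0\to1$. **Green function.** $G$ is the cardinality of $\eta^{\mathsf S}:C_1\to D_1$. For $w\in D_0$: $G_w$ is the cardinality of ${}_w(C_1)\to C_1\to D_1$, where ${}_w(C_1)$ is the homotopy fibre over $w$ of the composite $C_1\xrightarrow{\eta^{\mathsf S}}D_1\xrightarrow{d_1}D_0$ (operations with input sequence $w$); $G^w$ is the cardinality of $(D_1)_w\to D_1$, where $(D_1)_w$ is the homotopy fibre of $d_0:D_1\to D_0$ over $w$ (families of operations with output colours given by $w$; in the one-colour case with $w=k$ these are $k$-tuples of operations and $G^k$ is the $k$-th power of $G$). $\mathrm{Aut}(w)$ is the automorphism group of $w$ in $D_0$. *)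

(* Defs.v *)
From HB Require Import structures.
From mathcomp Require Import all_boot all_order all_algebra.
From mathcomp Require Import finmap generic_quotient.
From mathcomp Require Import boolp classical_sets functions cardinality fsbigop.

Set Implicit Arguments.
Unset Strict Implicit.
Unset Printing Implicit Defensive.

Import GRing.Theory.

(** * Groupoids *)

Declare Scope grpd_scope.
Delimit Scope grpd_scope with grpd.
Local Open Scope grpd_scope.

Local Obligation Tactic := idtac.

Record grpd := Grpd {
  gobj :> Type;
  ghom : gobj -> gobj -> Type;
  gid : forall x, ghom x x;
  gcomp : forall x y z, ghom y z -> ghom x y -> ghom x z;
  ginv : forall x y, ghom x y -> ghom y x;
  gidl : forall x y (f : ghom x y), gcomp (gid y) f = f;
  gidr : forall x y (f : ghom x y), gcomp f (gid x) = f;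
  gcompA : forall x y z t (h : ghom z t) (g : ghom y z) (f : ghom x y),
    gcomp h (gcomp g f) = gcomp (gcomp h g) f;
  ginvl : forall x y (f : ghom x y), gcomp (ginv f) f = gid x;
  ginvr : forall x y (f : ghom x y), gcomp f (ginv f) = gid y }.

Arguments gid {_} x.
Notation "g \; f" := (gcomp g f) : grpd_scope.

Record gfunctor (X Y : grpd) := GFunctor {
  fobj :> X -> Y;
  fhom : forall x y, ghom x y -> ghom (fobj x) (fobj y);
  fhom_id : forall x, fhom (gid x) = gid (fobj x);
  fhom_comp : forall x y z (g : ghom y z) (f : ghom x y),
    fhom (g \; f) = fhom g \; fhom f }.

Program Definition functor_comp (X Y Z : grpd)
    (G : gfunctor Y Z) (F : gfunctor X Y) : gfunctor X Z :=
  @GFunctor X Z (fun x => G (F x)) (fun x y f => fhom G (fhom F f)) _ _.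
Next Obligation. by move=> * /=; rewrite !fhom_id. Qed.
Next Obligation. by move=> * /=; rewrite !fhom_comp. Qed.

Program Definition gprod (X Y : grpd) : grpd :=
  @Grpd (X * Y)%type
    (fun u v => (ghom u.1 v.1 * ghom u.2 v.2)%type)
    (fun u => (gid u.1, gid u.2))
    (fun u v w g f => (g.1 \; f.1, g.2 \; f.2))
    (fun u v f => (ginv f.1, ginv f.2)) _ _ _ _ _.
Next Obligation. by move=> X Y x y [f g] /=; rewrite !gidl. Qed.
Next Obligation. by move=> X Y x y [f g] /=; rewrite !gidr. Qed.
Next Obligation. by move=> * /=; rewrite !gcompA. Qed.
Next Obligation. by move=> * /=; rewrite !ginvl. Qed.
Next Obligation. by move=> * /=; rewrite !ginvr. Qed.

Program Definition functor_pair (X Y Z : grpd)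
    (F : gfunctor X Y) (G : gfunctor X Z) : gfunctor X (gprod Y Z) :=
  @GFunctor X (gprod Y Z) (fun x => (F x, G x))
    (fun x y f => (fhom F f, fhom G f)) _ _.
Next Obligation. by move=> * /=; rewrite !fhom_id. Qed.
Next Obligation. by move=> * /=; rewrite !fhom_comp. Qed.

Lemma hfib_comp_subproof (X Y : grpd) (p : gfunctor X Y) (y : Y)
    (u v w : {x : X & ghom (p x) y})
    (g : {f : ghom (tag v) (tag w) | tagged w \; fhom p f = tagged v})
    (f : {f : ghom (tag u) (tag v) | tagged v \; fhom p f = tagged u}) :
  tagged w \; fhom p (sval g \; sval f) = tagged u.
Proof. by case: g f => [g eg] [f ef] /=; rewrite fhom_comp gcompA eg. Qed.

Lemma hfib_inv_subproof (X Y : grpd) (p : gfunctor X Y) (y : Y)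
    (u v : {x : X & ghom (p x) y})
    (f : {f : ghom (tag u) (tag v) | tagged v \; fhom p f = tagged u}) :
  tagged u \; fhom p (ginv (sval f)) = tagged v.
Proof.
case: f => [f e] /=.
by rewrite -e -gcompA -fhom_comp ginvr fhom_id gidr.
Qed.

Lemma sig_hom_eq (T : Type) (P : T -> Prop) (a b : {x | P x}) :
  sval a = sval b -> a = b.
Proof.
by case: a b => [a pa] [b pb] /= e; subst b; rewrite (Prop_irrelevance pa pb).
Qed.

(* The homotopy fibre of p over y: objects are pairs (x, p x ~ y). *)
Program Definition hfib (X Y : grpd) (p : gfunctor X Y) (y : Y) : grpd :=
  @Grpd {x : X & ghom (p x) y}
    (fun u v => {f : ghom (tag u) (tag v) | tagged v \; fhom p f = tagged u})
    (fun u => exist _ (gid (tag u)) _)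
    (fun u v w g f => exist _ (sval g \; sval f) (hfib_comp_subproof g f))
    (fun u v f => exist _ (ginv (sval f)) (hfib_inv_subproof f)) _ _ _ _ _.
Next Obligation. by move=> * /=; rewrite fhom_id gidr. Qed.
Next Obligation. by move=> *; apply: sig_hom_eq; exact: gidl. Qed.
Next Obligation. by move=> *; apply: sig_hom_eq; exact: gidr. Qed.
Next Obligation. by move=> *; apply: sig_hom_eq; exact: gcompA. Qed.
Next Obligation. by move=> *; apply: sig_hom_eq; exact: ginvl. Qed.
Next Obligation. by move=> *; apply: sig_hom_eq; exact: ginvr. Qed.

Program Definition hfib_proj (X Y : grpd) (p : gfunctor X Y) (y : Y) :
    gfunctor (hfib p y) X :=
  @GFunctor (hfib p y) X (fun u => tag u) (fun u v f => sval f) _ _.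
Next Obligation. by move=> * /=. Qed.
Next Obligation. by move=> * /=. Qed.

Program Definition gdiscrete (I : Type) : grpd :=
  @Grpd I (fun i j => i = j) (fun i => erefl)
    (fun i j k e e' => etrans e' e) (fun i j e => esym e) _ _ _ _ _.
Next Obligation. by move=> * /=. Qed.
Next Obligation. by move=> * /=. Qed.
Next Obligation. by move=> * /=. Qed.
Next Obligation. by move=> * /=. Qed.
Next Obligation. by move=> * /=. Qed.

(** * Isomorphism classes, finiteness, cardinality *)

Definition isorel (X : grpd) : rel {classic X} :=
  fun x y => `[< inhabited (@ghom X x y) >].

Lemma isorel_refl (X : grpd) : reflexive (@isorel X).
Proof. by move=> x; apply/asboolP; split; exact: gid. Qed.

Lemma isorel_sym (X : grpd) : symmetric (@isorel X).
Proof.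
by move=> x y; apply/asboolP/asboolP => -[f]; split; exact: ginv f.
Qed.

Lemma isorel_trans (X : grpd) : transitive (@isorel X).
Proof.
move=> y x z /asboolP[f] /asboolP[g]; apply/asboolP; split.
exact: (g \; f).
Qed.

Definition iso_equiv (X : grpd) : equiv_rel {classic X} :=
  EquivRel (@isorel X) (@isorel_refl X) (@isorel_sym X) (@isorel_trans X).

Definition pi0 (X : grpd) := {eq_quot (iso_equiv X)}%qT.
HB.instance Definition _ (X : grpd) := Choice.on (pi0 X).

Definition iso_class (X : grpd) (x : X) : pi0 X := (\pi_(pi0 X) x)%qT.
Definition representative (X : grpd) (c : pi0 X) : X := repr c.

Local Open Scope classical_set_scope.
Local Open Scope ring_scope.

(* Cardinal of a finite type in the sense of [finite_set] (0 otherwise). *)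
Definition ncard (T : Type) : nat := #|` fset_set [set: {classic T}]|%fset.

Definition locally_finite (X : grpd) : Prop :=
  forall x : X, finite_set [set: ghom x x].

Definition homotopy_finite (X : grpd) : Prop :=
  finite_set [set: pi0 X] /\ locally_finite X.

Definition finite_map (X Y : grpd) (p : gfunctor X Y) : Prop :=
  forall y : Y, homotopy_finite (hfib p y).

Definition aut_card (X : grpd) (x : X) : rat := (ncard (ghom x x))%:R.

(* Homotopy cardinality.  It is total, but only meaningful when X is homotopy
   finite; all the fibres it is applied to below are. *)
Definition hcard (X : grpd) : rat :=
  \sum_(c \in [set: pi0 X]) (aut_card (representative c))^-1.

(* Elements of the completion Q^(pi_0 Y), by their coordinates in the
   (topological) basis delta_y. *)
Definition qvec (Y : grpd) := pi0 Y -> rat.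

Definition map_card (X Y : grpd) (p : gfunctor X Y) : qvec Y :=
  fun c => hcard (hfib p (representative c)) / aut_card (representative c).

Definition tensor (Y Z : grpd) (f : qvec Y) (g : qvec Z) : qvec (gprod Y Z) :=
  fun c => f (iso_class (representative c).1) * g (iso_class (representative c).2).

(* Infinite sums in the completion: every coordinate is a sum with finitely
   many nonzero terms. *)
Definition summable (W : choiceType) (Y : grpd) (F : W -> qvec Y) : Prop :=
  forall c, finite_set [set w | F w c != 0].

Definition infinite_sum (W : choiceType) (Y : grpd) (F : W -> qvec Y) : qvec Y :=
  fun c => \sum_(w \in [set: W]) F w c.

Definition scale (Y : grpd) (a : rat) (f : qvec Y) : qvec Y :=
  fun c => a * f c.

(* A span Y <-u- M -v-> Z sends delta_y to the cardinality of the composite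
   M_y -> M -> Z, with M_y the homotopy fibre of u. *)
Definition span_basis (Y M Z : grpd) (u : gfunctor M Y) (v : gfunctor M Z)
    (y : Y) : qvec Z :=
  map_card (functor_comp v (hfib_proj u y)).

(* The terms of sum_y f_y . span(delta_y). *)
Definition span_terms (Y M Z : grpd) (u : gfunctor M Y) (v : gfunctor M Z)
    (f : qvec Y) (c : pi0 Y) : qvec Z :=
  scale (f c) (span_basis u v (representative c)).

Definition span_card (Y M Z : grpd) (u : gfunctor M Y) (v : gfunctor M Z)
    (f : qvec Y) : qvec Z :=
  infinite_sum (span_terms u v f).

Local Close Scope ring_scope.
Local Close Scope classical_set_scope.

(** * The groupoid of finite sets (skeletal) and sums of bijections *)

Record bij (m n : nat) := Bij {
  bfun :> 'I_m -> 'I_n;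
  binv : 'I_n -> 'I_m;
  bfunK : cancel bfun binv;
  binvK : cancel binv bfun }.

Lemma bij_eq m n (s t : bij m n) : bfun s =1 bfun t -> s = t.
Proof.
case: s t => [f f' fK f'K] [g g' gK g'K] /= /funext e; subst g.
have e : f' = g' by apply/funext => j; rewrite -[in LHS](g'K j) fK.
by subst g'; rewrite (Prop_irrelevance fK gK) (Prop_irrelevance f'K g'K).
Qed.

Definition bij_id n : bij n n := @Bij n n id id (fun=> erefl) (fun=> erefl).

Definition bij_comp m n p (t : bij n p) (s : bij m n) : bij m p :=
  @Bij m p (fun i => t (s i)) (fun k => binv s (binv t k))
    (can_comp (bfunK t) (bfunK s)) (can_comp (binvK s) (binvK t)).

Definition bij_inv m n (s : bij m n) : bij n m :=
  @Bij n m (binv s) s (binvK s) (bfunK s).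

(* 'I_(\sum_i k i) is identified with the disjoint union of the 'I_(k i)
   through the lexicographic enumeration tagnat.sig / tagnat.rank. *)
Definition sum_map m n (s : bij m n) (k : 'I_m -> nat) (l : 'I_n -> nat)
    (t : forall i, bij (k i) (l (s i))) (p : {i : 'I_m & 'I_(k i)}) :
    {i : 'I_n & 'I_(l i)} :=
  Tagged (fun i => 'I_(l i)) (t (tag p) (tagged p)).

Definition sum_inv m n (s : bij m n) (k : 'I_m -> nat) (l : 'I_n -> nat)
    (t : forall i, bij (k i) (l (s i))) (p : {i : 'I_n & 'I_(l i)}) :
    {i : 'I_m & 'I_(k i)} :=
  Tagged (fun i => 'I_(k i))
    (binv (t (binv s (tag p)))
       (cast_ord (f_equal l (esym (binvK s (tag p)))) (tagged p))).

Lemma sum_mapK m n (s : bij m n) k l (t : forall i, bij (k i) (l (s i))) :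
  cancel (sum_map t) (sum_inv t).
Proof.
case=> i j; rewrite /sum_map /sum_inv /=.
move: (f_equal _ _) => e.
move: (binvK s (s i)) e; rewrite (bfunK s i) => _ e.
by rewrite cast_ord_id bfunK.
Qed.

Lemma sum_invK m n (s : bij m n) k l (t : forall i, bij (k i) (l (s i))) :
  cancel (sum_inv t) (sum_map t).
Proof.
case=> i j; rewrite /sum_map /sum_inv /= (binvK (t _)).
move: (f_equal _ _) => e.
by move: (binvK s i) e => eqi; case: _ / (esym eqi) => e; rewrite cast_ord_id.
Qed.

Definition bij_sum m n (s : bij m n) (k : 'I_m -> nat) (l : 'I_n -> nat)
    (t : forall i, bij (k i) (l (s i))) :
    bij (\sum_(i < m) k i) (\sum_(i < n) l i) :=
  @Bij _ _ (fun q => tagnat.rank (sum_map t (tagnat.sig q)))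
    (fun q => tagnat.rank (sum_inv t (tagnat.sig q)))
    (fun q => etrans (f_equal (fun p => tagnat.rank (sum_inv t p))
                       (tagnat.rankK _))
               (etrans (f_equal tagnat.rank (sum_mapK _ _)) (tagnat.sigK q)))
    (fun q => etrans (f_equal (fun p => tagnat.rank (sum_map t p))
                       (tagnat.rankK _))
               (etrans (f_equal tagnat.rank (sum_invK _ _)) (tagnat.sigK q))).

(** * The symmetric monoidal category monad S *)

Definition eq_hom (X : grpd) (x y : X) (e : x = y) : ghom x y :=
  match e in _ = z return ghom x z with erefl => gid x end.

Lemma eq_hom_refl (X : grpd) (x : X) (e : x = x) : eq_hom e = gid x.
Proof. by rewrite (Prop_irrelevance e erefl). Qed.

Lemma eq_hom_trans (X : grpd) (x y z : X) (e : x = y) (e' : y = z)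
  (e'' : x = z) : eq_hom e' \; eq_hom e = eq_hom e''.
Proof. by case: _ / e' e'' => e''; rewrite gidl (Prop_irrelevance e e''). Qed.

Lemma eq_hom_nat (T : Type) (X : grpd) (f g : T -> X)
    (v : forall i, ghom (f i) (g i)) i j (e : i = j)
    (ef : f i = f j) (eg : g i = g j) :
  v j \; eq_hom ef = eq_hom eg \; v i.
Proof. by case: _ / e ef eg => ef eg; rewrite !eq_hom_refl gidl gidr. Qed.

Record fam (X : grpd) := Fam { flen : nat; fval :> 'I_flen -> X }.

Record fam_hom (X : grpd) (x y : fam X) := FamHom {
  hbij : bij (flen x) (flen y);
  hval : forall i, ghom (x i) (y (hbij i)) }.

Lemma fam_hom_eq (X : grpd) (x y : fam X) (h k : fam_hom x y)
    (e : hbij h =1 hbij k) :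
  (forall i (ei : y (hbij h i) = y (hbij k i)),
      eq_hom ei \; hval h i = hval k i) -> h = k.
Proof.
case: h k e => [s u] [t v] /= e H; have est := bij_eq e; subst t.
suff -> : u = v by [].
by apply: functional_extensionality_dep => i; rewrite -(H i erefl) gidl.
Qed.

Definition fam_id (X : grpd) (x : fam X) : fam_hom x x :=
  @FamHom X x x (bij_id _) (fun i => gid (x i)).

Definition fam_comp (X : grpd) (x y z : fam X)
    (g : fam_hom y z) (f : fam_hom x y) : fam_hom x z :=
  @FamHom X x z (bij_comp (hbij g) (hbij f))
    (fun i => hval g (hbij f i) \; hval f i).

Definition fam_inv (X : grpd) (x y : fam X) (f : fam_hom x y) : fam_hom y x :=
  @FamHom X y x (bij_inv (hbij f))
    (fun j => ginv (hval f (binv (hbij f) j))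
              \; eq_hom (f_equal (@fval X y) (esym (binvK (hbij f) j)))).

(* S(X): finite sequences of objects of X; a morphism is a permutation of the
   indices together with morphisms of X. *)
Program Definition S_grpd (X : grpd) : grpd :=
  @Grpd (fam X) (@fam_hom X) (@fam_id X) (@fam_comp X) (@fam_inv X) _ _ _ _ _.
Next Obligation.
move=> X x y f; apply: fam_hom_eq => [//|i ei /=].
by rewrite eq_hom_refl !gidl.
Qed.
Next Obligation.
move=> X x y f; apply: fam_hom_eq => [//|i ei /=].
by rewrite eq_hom_refl gidl gidr.
Qed.
Next Obligation.
move=> X x y z t h g f; apply: fam_hom_eq => [//|i ei /=].
by rewrite eq_hom_refl gidl gcompA.
Qed.
Next Obligation.
move=> X x y f; apply: fam_hom_eq => [|i ei /=]; first exact: bfunK (hbij f).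
rewrite -gcompA.
have e := bfunK (hbij f) i.
rewrite -[_ \; hval f i](@eq_hom_nat _ X (fun i => x i)
  (fun i => y (hbij f i)) (hval f) _ _ (esym e) (f_equal (@fval X x) (esym e))).
rewrite [ginv _ \; _]gcompA ginvl gidl.
by rewrite (eq_hom_trans _ _ erefl).
Qed.
Next Obligation.
move=> X x y f; apply: fam_hom_eq => [|i ei /=]; first exact: binvK (hbij f).
by rewrite [hval f _ \; _]gcompA ginvr gidl (eq_hom_trans _ _ erefl).
Qed.

Program Definition S_map (X Y : grpd) (F : gfunctor X Y) :
    gfunctor (S_grpd X) (S_grpd Y) :=
  @GFunctor (S_grpd X) (S_grpd Y)
    (fun x => @Fam Y (flen x) (fun i => F (x i)))
    (fun x y h => @FamHom Y (Fam (fun i => F (x i))) (Fam (fun i => F (y i)))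
                    (hbij h) (fun i => fhom F (hval h i))) _ _.
Next Obligation.
move=> X Y F x; apply: fam_hom_eq => [//|i ei /=].
by rewrite eq_hom_refl gidl fhom_id.
Qed.
Next Obligation.
move=> X Y F x y z g f; apply: fam_hom_eq => [//|i ei /=].
by rewrite eq_hom_refl gidl fhom_comp.
Qed.

(* eta^S: singleton families. *)
Program Definition S_unit (X : grpd) : gfunctor X (S_grpd X) :=
  @GFunctor X (S_grpd X) (fun x => @Fam X 1 (fun=> x))
    (fun x y f => @FamHom X (@Fam X 1 (fun=> x)) (@Fam X 1 (fun=> y))
                    (bij_id 1) (fun=> f)) _ _.
Next Obligation. by move=> * /=. Qed.
Next Obligation.
move=> X x y z g f; apply: fam_hom_eq => [//|i ei /=].
by rewrite eq_hom_refl gidl.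
Qed.

Definition fam2 (X : grpd) (x : fam (S_grpd X))
  (p : {i : 'I_(flen x) & 'I_(flen (x i))}) : X := x (tag p) (tagged p).

Definition concat (X : grpd) (x : fam (S_grpd X)) : fam X :=
  @Fam X (\sum_(i < flen x) flen (x i)) (fun q => fam2 (tagnat.sig q)).

Definition fam2_map (X : grpd) (x y : fam (S_grpd X)) (h : fam_hom x y) :
    {i : 'I_(flen x) & 'I_(flen (x i))} -> {i : 'I_(flen y) & 'I_(flen (y i))} :=
  sum_map (s := hbij h) (k := fun i => flen (x i)) (l := fun i => flen (y i))
    (fun i => hbij (hval h i)).

Definition concat_hom (X : grpd) (x y : fam (S_grpd X)) (h : fam_hom x y) :
    fam_hom (concat x) (concat y) :=
  @FamHom X (concat x) (concat y)
    (bij_sum (s := hbij h) (k := fun i => flen (x i)) (l := fun i => flen (y i))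
       (fun i => hbij (hval h i)))
    (fun q => let p := tagnat.sig q in
       eq_hom (f_equal (@fam2 X y) (esym (tagnat.rankK (fam2_map h p))))
       \; hval (hval h (tag p)) (tagged p)).

(* mu^S: concatenation. *)
Program Definition S_mult (X : grpd) :
    gfunctor (S_grpd (S_grpd X)) (S_grpd X) :=
  @GFunctor (S_grpd (S_grpd X)) (S_grpd X) (@concat X) (@concat_hom X) _ _.
Next Obligation.
move=> X x; have e q : @tagnat.rank _ (fun i => flen (x i))
    (sum_map (s := bij_id _) (fun i => bij_id _) (tagnat.sig q)) = q.
  by rewrite -[RHS]tagnat.sigK; case: (tagnat.sig q).
apply: fam_hom_eq => [|q ei /=]; first exact: e.
by rewrite gidr (eq_hom_trans _ _ erefl).
Qed.
Next Obligation.
move=> X x y z g f.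
pose Tf := fam2_map f.
pose Tg := fam2_map g.
have e q : tagnat.rank (Tg (Tf (tagnat.sig q))) =
    tagnat.rank (Tg (tagnat.sig (tagnat.rank (Tf (tagnat.sig q))))).
  by rewrite tagnat.rankK.
apply: fam_hom_eq => [|q ei /=]; first exact: e.
set p := tagnat.sig q.
rewrite [eq_hom ei \; _]gcompA !gcompA; congr (_ \; _).
rewrite -[RHS]gcompA.
have E := tagnat.rankK (Tf p).
rewrite (@eq_hom_nat _ X (@fam2 X y) (fun r => fam2 (Tg r))
  (fun r => hval (hval g (tag r)) (tagged r)) _ _ (esym E) _
  (f_equal (fun r => fam2 (Tg r)) (esym E))).
rewrite gcompA; congr (_ \; _).
have eq : @fam2 X z (Tg (Tf p)) =
  fam2 (tagnat.sig (tagnat.rank (Tg (tagnat.sig (tagnat.rank (Tf p)))))).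
  by rewrite !tagnat.rankK.
by rewrite (eq_hom_trans _ _ eq) (eq_hom_trans _ _ eq).
Qed.

(** * Operads *)

(* Coloured symmetric operads in sets.  [op n] is the set of n-ary operations;
   [act] is the functor from the groupoid of the finite sets 'I_n to sets whose
   category of elements is B (that is, an action of the symmetric group S_n on
   each [op n], since there are no bijections 'I_m -> 'I_n for m <> n). *)
Record operad := Operad {
  colour : Type;
  op : nat -> Type;
  inp : forall n, op n -> 'I_n -> colour;
  out : forall n, op n -> colour;
  act : forall m n, bij m n -> op m -> op n;
  act_id : forall n (b : op n), act (bij_id n) b = b;
  act_comp : forall m n p (t : bij n p) (s : bij m n) (b : op m),
    act (bij_comp t s) b = act t (act s b);
  inp_act : forall m n (s : bij m n) (b : op m) i, inp (act s b) (s i) = inp b i;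
  out_act : forall m n (s : bij m n) (b : op m), out (act s b) = out b;
  one : colour -> op 1;
  inp_one : forall c i, inp (one c) i = c;
  out_one : forall c, out (one c) = c;
  subst : forall n (b : op n) (k : 'I_n -> nat) (c : forall i, op (k i)),
    (forall i, out (c i) = inp b i) -> op (\sum_(i < n) k i);
  inp_subst : forall n (b : op n) (k : 'I_n -> nat) (c : forall i, op (k i))
    (h : forall i, out (c i) = inp b i) q,
    inp (subst h) q = inp (c (tagnat.sig1 q)) (tagnat.sig2 q);
  out_subst : forall n (b : op n) (k : 'I_n -> nat) (c : forall i, op (k i))
    (h : forall i, out (c i) = inp b i), out (subst h) = out b;
  subst_act : forall m n (s : bij m n) (b : op m)
    (k : 'I_m -> nat) (c : forall i, op (k i)) (h : forall i, out (c i) = inp b i)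
    (l : 'I_n -> nat) (d : forall i, op (l i))
    (h' : forall i, out (d i) = inp (act s b) i)
    (t : forall i, bij (k i) (l (s i))),
    (forall i, act (t i) (c i) = d (s i)) ->
    act (bij_sum t) (subst h) = subst h';
  subst_onel : forall n (b : op n)
    (h : forall i : 'I_1, out b = inp (one (out b)) i),
    existT op _ (subst h) = existT op n b;
  subst_oner : forall n (b : op n)
    (h : forall i, out (one (inp b i)) = inp b i),
    existT op _ (subst h) = existT op n b;
  subst_assoc : forall n (a : op n)
    (k : 'I_n -> nat) (b : forall i, op (k i)) (hb : forall i, out (b i) = inp a i)
    (l : forall i, 'I_(k i) -> nat) (c : forall i j, op (l i j))
    (hc : forall i j, out (c i j) = inp (b i) j)
    (h1 : forall q, out (c (tagnat.sig1 q) (tagnat.sig2 q)) = inp (subst hb) q)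
    (h2 : forall i, out (subst (hc i)) = inp a i),
    existT op _ (subst h1) = existT op _ (subst h2) }.

Arguments inp {_ n} b i.
Arguments out {_ n} b.
Arguments act {_ m n} s b.
Arguments one {_} c.
Arguments subst {_ n b k c} h.

(** * The polynomial monad R of an operad *)

(* The strict slice Grpd/I over a set I. *)
Record over (I : Type) := Over {
  total :> grpd;
  col : total -> I;
  col_hom : forall x y : total, ghom x y -> col x = col y }.

Record over_map (I : Type) (X Y : over I) := OverMap {
  over_fun :> gfunctor X Y;
  col_map : forall x, col (over_fun x) = col x }.

(* Objects of R(X) = t_! p_* s^* X: an operation b and a map E_b -> X over I.
   The underlying family of objects of X is the image under phi. *)
Record tree (R : operad) (X : over (colour R)) := Tree {
  tfam : fam X;
  troot : op R (flen tfam);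
  tcol : forall i, col (tfam i) = inp troot i }.

Arguments tcol {_ _} t i.

Definition tree_hom (R : operad) (X : over (colour R)) (x y : tree X) :=
  {h : fam_hom (tfam x) (tfam y) | act (hbij h) (troot x) = troot y}.

Program Definition R_grpd (R : operad) (X : over (colour R)) : grpd :=
  @Grpd (tree X) (@tree_hom R X)
    (fun x => exist _ (fam_id (tfam x)) _)
    (fun x y z g f => exist _ (fam_comp (sval g) (sval f)) _)
    (fun x y f => exist _ (fam_inv (sval f)) _) _ _ _ _ _.
Next Obligation. by move=> *; exact: act_id. Qed.
Next Obligation. by move=> R X x y z [g eg] [f ef] /=; rewrite act_comp ef. Qed.
Next Obligation.
move=> R X x y [f /= <-]; rewrite -act_comp -[RHS]act_id.
by congr act; apply: bij_eq => i /=; rewrite bfunK.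
Qed.
Next Obligation. by move=> *; apply: sig_hom_eq; exact: (@gidl (S_grpd _)). Qed.
Next Obligation. by move=> *; apply: sig_hom_eq; exact: (@gidr (S_grpd _)). Qed.
Next Obligation. by move=> *; apply: sig_hom_eq; exact: (@gcompA (S_grpd _)). Qed.
Next Obligation. by move=> *; apply: sig_hom_eq; exact: (@ginvl (S_grpd _)). Qed.
Next Obligation. by move=> *; apply: sig_hom_eq; exact: (@ginvr (S_grpd _)). Qed.

Program Definition R_over (R : operad) (X : over (colour R)) :
    over (colour R) :=
  @Over _ (R_grpd X) (fun x : tree X => out (troot x)) _.
Next Obligation. by move=> R X x y [h /= <-]; rewrite out_act. Qed.

Program Definition R_map (R : operad) (X Y : over (colour R))
    (F : over_map X Y) : over_map (R_over X) (R_over Y) :=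
  @OverMap _ (R_over X) (R_over Y)
    (@GFunctor (R_grpd X) (R_grpd Y)
       (fun x => @Tree R Y (S_map F (tfam x)) (troot x) _)
       (fun x y h => exist _ (fhom (S_map F) (sval h)) (svalP h)) _ _) _.
Next Obligation. by move=> R X Y F x i /=; rewrite col_map tcol. Qed.
Next Obligation.
by move=> *; apply: sig_hom_eq; exact: (@fhom_id _ _ (S_map _)).
Qed.
Next Obligation.
by move=> *; apply: sig_hom_eq; exact: (@fhom_comp _ _ (S_map _)).
Qed.
Next Obligation. by move=> * /=. Qed.

Program Definition phi (R : operad) (X : over (colour R)) :
    gfunctor (R_over X) (S_grpd X) :=
  @GFunctor (R_over X) (S_grpd X) (fun x : tree X => tfam x)
    (fun x y h => sval h) _ _.
Next Obligation. by move=> * /=. Qed.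
Next Obligation. by move=> * /=. Qed.

(* On underlying families, mu is mu^S o S(phi) o phi. *)
Definition mult_fam (R : operad) (X : over (colour R)) :
    gfunctor (R_over (R_over X)) (S_grpd X) :=
  functor_comp (S_mult X) (functor_comp (S_map (phi X)) (phi (R_over X))).

Program Definition R_mult (R : operad) (X : over (colour R)) :
    over_map (R_over (R_over X)) (R_over X) :=
  @OverMap _ (R_over (R_over X)) (R_over X)
    (@GFunctor (R_grpd (R_over X)) (R_grpd X)
       (fun x => @Tree R X (mult_fam X x) (subst (tcol x)) _)
       (fun x y h => exist _ (fhom (mult_fam X) h) _) _ _) _.
Next Obligation. by move=> R X x q /=; rewrite inp_subst /fam2 tcol. Qed.
Next Obligation.
move=> R X x y [h e] /=.
move: (troot y) (tcol y) e => b c e; move: c; rewrite -e => c.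
apply: subst_act => i; exact: svalP (hval h i).
Qed.
Next Obligation.
by move=> R X x; apply: sig_hom_eq; exact: (@fhom_id _ _ (mult_fam X)).
Qed.
Next Obligation.
by move=> R X x y z g f; apply: sig_hom_eq; exact: (@fhom_comp _ _ (mult_fam X)).
Qed.
Next Obligation. by move=> R X x /=; rewrite out_subst. Qed.

Program Definition R_unit (R : operad) (X : over (colour R)) :
    over_map X (R_over X) :=
  @OverMap _ X (R_over X)
    (@GFunctor X (R_grpd X)
       (fun x => @Tree R X (S_unit X x) (one (col x)) _)
       (fun x y f => exist _ (fhom (S_unit X) f) _) _ _) _.
Next Obligation. by move=> R X x i /=; rewrite inp_one. Qed.
Next Obligation. by move=> R X x y f /=; rewrite act_id (col_hom f). Qed.
Next Obligation.
by move=> *; apply: sig_hom_eq; exact: (@fhom_id _ _ (S_unit _)).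
Qed.
Next Obligation.
by move=> *; apply: sig_hom_eq; exact: (@fhom_comp _ _ (S_unit _)).
Qed.
Next Obligation. by move=> R X x /=; rewrite out_one. Qed.

(* Components are taken at locally finite groupoids over the set of colours,
   all groupoids being assumed locally finite. *)
Definition operad_locally_finite (R : operad) : Prop :=
  forall X : over (colour R), locally_finite X ->
    finite_map (R_mult X) /\ finite_map (R_unit X).

(** * Bar construction *)

(* The terminal object of Grpd/I and the terminal R-algebra. *)
Definition A_over (R : operad) : over (colour R) :=
  @Over _ (gdiscrete (colour R)) id (fun _ _ => id).

Program Definition alpha (R : operad) : over_map (R_over (A_over R)) (A_over R) :=
  @OverMap _ (R_over (A_over R)) (A_over R)
    (@GFunctor (R_over (A_over R)) (gdiscrete (colour R))
       (fun x => col x) (fun x y h => col_hom h) _ _) _.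
Next Obligation. by move=> * /=. Qed.
Next Obligation. by move=> * /=. Qed.
Next Obligation. by move=> * /=. Qed.

Fixpoint R_pow (R : operad) (n : nat) : over (colour R) :=
  if n is n'.+1 then R_over (R_pow R n') else A_over R.

Definition C (R : operad) (n : nat) : grpd := R_pow R n.
Definition D (R : operad) (n : nat) : grpd := S_grpd (C R n).

(* d_k : C_(n+1) -> C_n for k <= n, that is R^(n-k) applied to
   mu_(R^(k-1) A), resp. to alpha if k = 0. *)
Fixpoint C_face (R : operad) (n k : nat) :
    over_map (R_pow R n.+1) (R_pow R n) :=
  if n is n'.+1 return over_map (R_pow R n.+1) (R_pow R n)
  then if k == n'.+1 then R_mult (R_pow R n') else R_map (C_face R n' k)
  else alpha R.

(* d_k : D_(n+1) -> D_n for k <= n+1. *)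
Definition face (R : operad) (n k : nat) : gfunctor (D R n.+1) (D R n) :=
  if k == n.+1 then functor_comp (S_mult (C R n)) (S_map (phi (R_pow R n)))
  else S_map (C_face R n k).

(** * Comultiplication and Green functions *)

(* The terms G_x Delta(delta_x) of Delta(G), and Delta on the completion: the
   span D_1 <-d_1- D_2 -(d_2,d_0)-> D_1 * D_1. *)
Definition comult_terms (R : operad) :
    qvec (D R 1) -> pi0 (D R 1) -> qvec (gprod (D R 1) (D R 1)) :=
  span_terms (face R 1 1) (functor_pair (face R 1 2) (face R 1 0)).

Definition comult (R : operad) : qvec (D R 1) -> qvec (gprod (D R 1) (D R 1)) :=
  span_card (face R 1 1) (functor_pair (face R 1 2) (face R 1 0)).

Definition green (R : operad) : qvec (D R 1) := map_card (S_unit (C R 1)).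

(* G_w *)
Definition green_in (R : operad) (w : D R 0) : qvec (D R 1) :=
  map_card (functor_comp (S_unit (C R 1))
    (hfib_proj (functor_comp (face R 0 1) (S_unit (C R 1))) w)).

(* G^w *)
Definition green_out (R : operad) (w : D R 0) : qvec (D R 1) :=
  map_card (hfib_proj (face R 0 0) w).

Arguments comult_terms R f c : clear implicits.
Arguments comult R f : clear implicits.
Arguments green R : clear implicits.
Arguments green_in R w : clear implicits.
Arguments green_out R w : clear implicits.

(* Main.v *)
(* All the groupoids whose cardinality enters the two sides are equivalent to
   sets.  Fix a coordinate, given by families y1 and y2 of operations.  The Segal
   property says that D_2 is the homotopy pullback of d_0 and d_1 : D_1 -> D_0,
   so the homotopy fibre of (d_2, d_0) over (y1, y2) is the set
   Hom(d_0 y1, d_1 y2).  As eta^S is fully faithful, the coordinates of G select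
   the composites that are single operations, i.e. the y2 of length 1, and
   summing over these composites gives
     [y2 has length 1] * #Hom(d_0 y1, d_1 y2) / (#Aut y1 * #Aut y2).
   On the other side, G^w and G_w count Hom(d_0 y1, w) and Hom(d_1 y2, w), up to
   the same denominators, so that only the class w of d_0 y1 contributes, and
   the factor 1/#Aut w leaves #Hom(d_0 y1, d_1 y2). *)

Require Import Defs.
From mathcomp Require Import all_boot all_order all_algebra.
From mathcomp Require Import finmap generic_quotient.
From mathcomp Require Import boolp classical_sets functions cardinality fsbigop.

Set Implicit Arguments.
Unset Strict Implicit.
Unset Printing Implicit Defensive.

Import Order.TTheory GRing.Theory Num.Theory.
Local Open Scope classical_set_scope.
Local Open Scope ring_scope.
Local Open Scope grpd_scope.

(** * Counting *)

Lemma finite_finType_bij (T : Type) : finite_set [set: T] ->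
  exists (F : finType) (f : T -> F), bijective f.
Proof.
move=> /(@finite_fsetP {classic T})[X eX].
have inX (t : {classic T}) : t \in X.
  by have : [set` X] t by rewrite -eX.
exists X, (fun t => [` inX t]%fset), (fun x : X => val x) => [//|x].
exact: val_inj.
Qed.

Lemma finite_inj (T U : Type) (f : T -> U) :
  injective f -> finite_set [set: U] -> finite_set [set: T].
Proof.
move=> f_inj finU; rewrite -(preimage_setT f).
by apply: finite_preimage => // x y _ _; exact: f_inj.
Qed.

(** The count is transferred to a [finType], where the theory of [#|_|] applies; the computations of
    [ncard] below rest on this. *)
Lemma ncard_fin (T : Type) (F : finType) (f : T -> F) :
  bijective f -> ncard T = #|F|.
Proof.
move=> f_bij; have f_inj := bij_inj f_bij; case: f_bij => g fK gK.
have finT : finite_set [set: {classic T}] := finite_inj f_inj finite_finset.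
rewrite /ncard.
have -> : fset_set [set: {classic T}] = [fset (g x : {classic T}) | x in F]%fset.
  apply/fsetP => x; rewrite in_fset_set // in_setT.
  by apply/esym/imfsetP; exists (f x).
by rewrite card_imfset /=; [rewrite cardE | exact: can_inj gK].
Qed.

Lemma ncard_bij (T U : Type) (f : T -> U) :
  finite_set [set: U] -> bijective f -> ncard T = ncard U.
Proof.
move=> /finite_finType_bij[F [g g_bij]] f_bij.
by rewrite (ncard_fin g_bij) (ncard_fin (bij_comp g_bij f_bij)).
Qed.

Lemma ncard_prod (T U : Type) : finite_set [set: T] -> finite_set [set: U] ->
  ncard (T * U) = (ncard T * ncard U)%N.
Proof.
move=> /finite_finType_bij[F [f [f' fK f'K]]].
move=> /finite_finType_bij[G [g [g' gK g'K]]].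
have fb : bijective f by exists f'.
have gb : bijective g by exists g'.
rewrite (ncard_fin fb) (ncard_fin gb) -card_prod.
apply: (@ncard_fin _ _ (fun p => (f p.1, g p.2))).
by exists (fun p => (f' p.1, g' p.2)) => -[a b] /=; rewrite ?fK ?gK ?f'K ?g'K.
Qed.

Lemma ncard_eq1 (T : Type) (t : T) : (forall u, u = t) -> ncard T = 1%N.
Proof.
move=> tP; rewrite -card_unit; apply: (@ncard_fin _ _ (fun=> tt)).
by exists (fun=> t) => [x|[]].
Qed.

Lemma ncard_eq0 (T : Type) : (T -> False) -> ncard T = 0%N.
Proof.
move=> TF; rewrite -card_void; apply: (@ncard_fin _ _ (fun t => False_rect _ (TF t))).
by exists (@of_void T) => [t|[]]; case: (TF t).
Qed.

Lemma ncard_gt0 (T : Type) (t : T) : finite_set [set: T] -> (0 < ncard T)%N.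
Proof.
move=> /finite_finType_bij[F [f f_bij]]; rewrite (ncard_fin f_bij).
by apply/card_gt0P; exists (f t).
Qed.

Lemma finite_fibres_support (T : Type) (W : choiceType) (k : T -> W) :
  finite_set [set: T] -> finite_set [set w | ((ncard {t | k t = w})%:R : rat) != 0].
Proof.
move=> finT; apply: sub_finite_set (finite_image k finT) => w /=.
case: (pselect (exists t, k t = w)) => [[t <-] _|nw]; first by exists t.
by rewrite ncard_eq0 ?eqxx // => -[t tw]; apply: nw; exists t.
Qed.

(** Double counting: each element of [T] lies over exactly one [w]. This serves twice, for [hcard]
    and for the sum over composites in the comultiplication. *)
Lemma sum_ncard_fibres (T : Type) (W : choiceType) (k : T -> W) :
  finite_set [set: T] ->
  \sum_(w \in [set: W]) ((ncard {t | k t = w})%:R : rat) = (ncard T)%:R.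
Proof.
move=> finT; have [F [f f_bij]] := finite_finType_bij finT.
rewrite (ncard_fin f_bij); case: f_bij => g fK gK.
pose A := [fset k (g x) | x in F]%fset.
have fibre w : ncard {t | k t = w} = #|[pred x | k (g x) == w]|.
  have fP (p : {t | k t = w}) : k (g (f (sval p))) == w.
    by case: p => t /= /eqP; rewrite fK.
  rewrite (_ : #|_| = #|{: {x | k (g x) == w}}|); last by rewrite card_sig.
  apply: (@ncard_fin _ _ (fun p => exist _ (f (sval p)) (fP p))).
  exists (fun q => exist _ (g (sval q)) (eqP (svalP q))) => [p|q].
    by apply: sig_hom_eq => /=; rewrite fK.
  by apply: val_inj => /=; rewrite gK.
(* [A] is the finite image of [k]; outside it the fibres are empty. *)
rewrite (fsbigTE A) => [|w]; last first.
  move=> wA; rewrite fibre (_ : #|_| = 0%N) //.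
  apply: eq_card0 => x; apply: contraNF wA => /eqP <-.
  by apply/imfsetP; exists x.
under eq_bigr => w _ do rewrite fibre -sum1_card big_mkcond /= natr_sum.
rewrite exchange_big /= -sum1_card natr_sum; apply: eq_bigr => x _.
rewrite (big_fsetD1 (k (g x))) /=; last by apply/imfsetP; exists x.
rewrite inE eqxx big_seq big1 ?addr0 // => w; rewrite !inE => /andP[wx _].
by rewrite eq_sym (negbTE wx).
Qed.

(** * Homotopy fibres equivalent to sets *)

Lemma gcomp_injl (X : grpd) (x y z : X) (g : ghom y z) (f f' : ghom x y) :
  g \; f = g \; f' -> f = f'.
Proof. by move=> /(congr1 (gcomp (ginv g))); rewrite !gcompA ginvl !gidl. Qed.

Lemma gcomp_injr (X : grpd) (x y z : X) (g g' : ghom y z) (f : ghom x y) :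
  g \; f = g' \; f -> g = g'.
Proof.
by move=> /(congr1 (fun h => h \; ginv f)); rewrite -!gcompA ginvr !gidr.
Qed.

Lemma gcompK (X : grpd) (x y z : X) (g : ghom y z) (f : ghom x y) :
  ginv g \; (g \; f) = f.
Proof. by rewrite gcompA ginvl gidl. Qed.

Lemma gcompVK (X : grpd) (x y z : X) (g : ghom z y) (f : ghom x y) :
  g \; (ginv g \; f) = f.
Proof. by rewrite gcompA ginvr gidl. Qed.

Lemma fhom_inv (X Y : grpd) (F : gfunctor X Y) (x y : X) (f : ghom x y) :
  fhom F (ginv f) = ginv (fhom F f).
Proof.
by apply: (@gcomp_injl _ _ _ _ (fhom F f)); rewrite -fhom_comp !ginvr fhom_id.
Qed.

(** * Isomorphism classes and the sizes of Hom-sets *)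

Lemma iso_classP (X : grpd) (x y : X) :
  iso_class x = iso_class y <-> inhabited (ghom x y).
Proof.
split=> [/eqP|xy].
  by rewrite /iso_class (@eqmodE _ (iso_equiv X)) => /asboolP.
by apply/eqP; rewrite /iso_class (@eqmodE _ (iso_equiv X)); apply/asboolP.
Qed.

Lemma representativeK (X : grpd) : cancel (@representative X) (@iso_class X).
Proof. by move=> c; exact: reprK. Qed.

(** A nonempty Hom-set is a torsor under [ghom x x]: composing with the inverse of one [f] embeds it
    there. *)
Lemma locally_finite_hom (X : grpd) (x y : X) :
  locally_finite X -> finite_set [set: ghom x y].
Proof.
move=> finX; case: (pselect (inhabited (ghom x y))) => [[f]|xy].
  apply: (@finite_inj _ (ghom x x) (fun g => ginv f \; g)) => [g g'|].
    exact: gcomp_injl.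
  exact: finX.
apply: (@finite_inj _ void (fun g => False_rect _ (xy (inhabits g)))).
  by move=> g; case: (xy (inhabits g)).
exact: finite_finset.
Qed.

Lemma ncard_hom_iso (X : grpd) (x x' y y' : X) : locally_finite X ->
  ghom x x' -> ghom y y' -> ncard (ghom x y) = ncard (ghom x' y').
Proof.
move=> finX a b; apply: (@ncard_bij _ _ (fun f => b \; (f \; ginv a))).
  exact: locally_finite_hom.
exists (fun f => ginv b \; (f \; a)) => f.
  by rewrite -!gcompA gcompK ginvl gidr.
by rewrite -!gcompA gcompVK ginvr gidr.
Qed.

Lemma ncard_hom_sym (X : grpd) (x y : X) : locally_finite X ->
  ncard (ghom x y) = ncard (ghom y x).
Proof.
have invK u v : cancel (@ginv X u v) (@ginv X v u).
  move=> f; apply: (@gcomp_injl _ _ _ _ (ginv f)).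
  by rewrite ginvr ginvl.
move=> finX; apply: (@ncard_bij _ _ (fun f => ginv f)).
  exact: locally_finite_hom.
by exists (@ginv X y x).
Qed.

Lemma aut_card_neq0 (X : grpd) (x : X) : locally_finite X -> aut_card x != 0.
Proof.
by move=> finX; rewrite pnatr_eq0 -lt0n; apply: ncard_gt0 (gid x) _; exact: finX.
Qed.

Lemma aut_card_iso (X : grpd) (x y : X) : locally_finite X -> ghom x y ->
  aut_card x = aut_card y.
Proof. by move=> finX f; rewrite /aut_card (ncard_hom_iso finX f f). Qed.

Lemma aut_card_prod (X Y : grpd) (z : gprod X Y) : locally_finite X ->
  locally_finite Y -> aut_card z = aut_card z.1 * aut_card z.2.
Proof. by move=> finX finY; rewrite /aut_card -natrM -ncard_prod. Qed.

(* A transversal of [X] shows that [X] is equivalent to the discrete groupoid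
   on [T]. *)
Record pi0_transversal (X : grpd) (T : Type) (s : T -> X) : Prop := Transversal {
  thin : forall (x y : X) (f g : ghom x y), f = g;
  tr_inj : forall t t', ghom (s t) (s t') -> t = t';
  tr_surj : forall x, exists t, inhabited (ghom (s t) x) }.

(** By thinness every component contributes 1, and [s] identifies [T] with the set of components, so
    over each class [c] there is exactly one [t]. *)
Lemma hcard_transversal (X : grpd) (T : Type) (s : T -> X) :
  pi0_transversal s -> finite_set [set: T] -> hcard X = (ncard T)%:R.
Proof.
move=> sT finT; rewrite -(sum_ncard_fibres (fun t => iso_class (s t)) finT).
apply: eq_fsbigr => c _.
rewrite /aut_card (ncard_eq1 (fun f => thin sT f (gid _))) invr1.
have [t st] := tr_surj sT (representative c).
have tc : iso_class (s t) = c by rewrite -[RHS]representativeK; apply/iso_classP.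
rewrite (@ncard_eq1 _ (exist _ t tc)) // => -[t' t'c].
apply: sig_hom_eq => /=; move: t'c; rewrite -tc => /iso_classP[].
exact: tr_inj.
Qed.

Lemma hcard_empty (X : grpd) : (X -> False) -> hcard X = 0.
Proof.
by move=> X0; rewrite /hcard fsbig1 // => c; case: (X0 (representative c)).
Qed.

Definition full_faithful (X Y : grpd) (F : gfunctor X Y) : Prop :=
  forall x y (g : ghom (F x) (F y)), exists2 f, fhom F f = g &
    forall f', fhom F f' = g -> f' = f.

Lemma faithful (X Y : grpd) (F : gfunctor X Y) : full_faithful F ->
  forall x y, injective (@fhom _ _ F x y).
Proof.
move=> ffF x y f g fg; have [h _ hP] := ffF _ _ (fhom F g).
by rewrite (hP _ fg) (hP g).
Qed.

(** It allows a bare projection, as in [green_out], to be treated as a projection followed by a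
    fully faithful functor. *)
Definition functor_id (X : grpd) : gfunctor X X :=
  @GFunctor X X id (fun _ _ f => f) (fun=> erefl) (fun _ _ _ _ _ => erefl).

Lemma functor_comp_idl (X Y : grpd) (F : gfunctor X Y) :
  functor_comp (functor_id Y) F = F.
Proof. by case: F => *; congr GFunctor; exact: Prop_irrelevance. Qed.

Lemma full_faithful_id (X : grpd) : full_faithful (functor_id X).
Proof. by move=> x y g; exists g. Qed.

Definition fib_pt (X Y : grpd) (p : gfunctor X Y) (y : Y) (x : X)
  (f : ghom (p x) y) : hfib p y := existT _ x f.

Definition fib_hom (X Y : grpd) (p : gfunctor X Y) (y : Y) (x x' : X)
    (a : ghom (p x) y) (a' : ghom (p x') y) (f : ghom x x')
    (e : a' \; fhom p f = a) : ghom (fib_pt a) (fib_pt a') :=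
  exist (fun f => a' \; fhom p f = a) f e.

(** Up to isomorphism [(b, e)] is the only point of the fibre of [F] over [y], so the remaining
    freedom is the comparison [u]. A morphism compatible with [e] on both sides is the identity of
    [b], so distinct [u] stay non-isomorphic. *)
Lemma transversal_ff (X Y Z : grpd) (F : gfunctor X Y) (p : gfunctor X Z) w
    (y : Y) (b : X) (e : ghom (F b) y) : full_faithful F ->
  pi0_transversal (fun u : ghom (p b) w =>
    @fib_pt _ _ (functor_comp F (hfib_proj p w)) y (fib_pt u) e).
Proof.
move=> ffF; split=> [[[c u] d] [[c' u'] d'] [[f fu] fd] [[g gu] gd]
  |u u' [[f /= fu] fd]|[[c u] d]].
- do 2!apply: sig_hom_eq => /=; move: fd gd => /= fd gd.
  by apply: (faithful ffF); apply: (@gcomp_injl _ _ _ _ d'); rewrite fd.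
- move: fd => /= fd; rewrite -fu.
  have -> : f = gid b.
    apply: (faithful ffF); apply: (@gcomp_injl _ _ _ _ e).
    by rewrite fd fhom_id gidr.
  by rewrite fhom_id gidr.
- have [f fE _] := ffF b c (ginv d \; e); exists (u \; fhom p f).
  split; unshelve refine (exist _ (exist _ f _) _) => //=.
  by rewrite fE gcompVK.
Qed.

Lemma transversal_unit_ff (X Y : grpd) (F : gfunctor X Y) (y : Y) (b : X)
    (e : ghom (F b) y) : full_faithful F ->
  pi0_transversal (fun _ : unit => fib_pt e).
Proof.
move=> ffF; split=> [[c d] [c' d'] [f fd] [g gd]|[] []|[c d]] //.
- apply: sig_hom_eq => /=; move: fd gd => /= fd gd.
  by apply: (faithful ffF); apply: (@gcomp_injl _ _ _ _ d'); rewrite fd.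
- have [f fE _] := ffF b c (ginv d \; e); exists tt.
  by split; exists f => /=; rewrite fE gcompVK.
Qed.

(** The two fibres may be taken in either order: over the points [s t] representing the fibre of
    [q], passing to the fibre of [p] only adds a morphism to [x]. *)
Lemma transversal_span (M X Y : grpd) (p : gfunctor M X) (q : gfunctor M Y)
    (x : X) (y : Y) (T : Type) (s : T -> hfib q y) : pi0_transversal s ->
  pi0_transversal (fun a : {t : T & ghom (p (tag (s t))) x} =>
    @fib_pt _ _ (functor_comp q (hfib_proj p x)) y
      (fib_pt (tagged a)) (tagged (s (tag a)))).
Proof.
move=> sT; split=> [[[c u] d] [[c' u'] d'] [[f fu] fd] [[g gu] gd]
  |[t u] [t' u'] [[f /= fu] fd]|[[c u] d]].
- do 2!apply: sig_hom_eq => /=; move: fd gd => /= fd gd.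
  have := thin sT (@fib_hom _ _ q y c c' d d' f fd) (@fib_hom _ _ q y c c' d d' g gd).
  by move=> /(congr1 sval).
- move: fd => /= fd; have fH : ghom (s t) (s t') by exists f.
  have tt' := tr_inj sT fH; subst t'; congr (existT _ _ _).
  have := thin sT (exist _ f fd : ghom (s t) (s t)) (gid _).
  by move=> /(congr1 sval) /= fE; rewrite -fu fE fhom_id gidr.
- have [t [[f fE]]] := tr_surj sT (@fib_pt _ _ q y c d).
  exists (existT _ t (u \; fhom p f)).
  by split; unshelve refine (exist _ (exist _ f _) _).
Qed.

(* The hypotheses say that [M] is the homotopy pullback of [e1] and [e2]. *)
Lemma transversal_pullback (M X1 X2 Z : grpd) (p1 : gfunctor M X1)
    (p2 : gfunctor M X2) (e1 : gfunctor X1 Z) (e2 : gfunctor X2 Z)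
    (sigma : forall t, ghom (e1 (p1 t)) (e2 (p2 t))) (y1 : X1) (y2 : X2)
    (s : ghom (e1 y1) (e2 y2) -> hfib (functor_pair p1 p2) (y1, y2)) :
  (forall t t' (k : ghom t t'),
     fhom e2 (fhom p2 k) \; sigma t = sigma t' \; fhom e1 (fhom p1 k)) ->
  (forall t t' (k k' : ghom t t'),
     fhom p1 k = fhom p1 k' -> fhom p2 k = fhom p2 k' -> k = k') ->
  (forall t t' (m : ghom (p1 t) (p1 t')) (n : ghom (p2 t) (p2 t')),
     fhom e2 n \; sigma t = sigma t' \; fhom e1 m ->
     exists k, fhom p1 k = m /\ fhom p2 k = n) ->
  (forall h, fhom e2 (tagged (s h)).2 \; sigma (tag (s h)) =
     h \; fhom e1 (tagged (s h)).1) ->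
  pi0_transversal s.
Proof.
move=> sigma_nat p_faithful p_full sE; split.
- move=> [t [a b]] [t' [a' b']] [f fE] [g gE]; apply: sig_hom_eq => /=.
  move: fE gE => /= [f1 f2] [g1 g2].
  by apply: p_faithful; [apply: (gcomp_injl (g := a'))|apply: (gcomp_injl (g := b'))];
    rewrite ?f1 ?f2.
- move=> h h' [k kE]; have := sE h; have := sE h'.
  move: (s h) (s h') k kE => [t [a b]] [t' [a' b']] k /= [<- <-] E' E.
  apply: (gcomp_injr (f := fhom e1 (a' \; fhom p1 k))); rewrite -E.
  by rewrite !fhom_comp -gcompA sigma_nat !gcompA E'.
- move=> [t [a b]].
  (* The only candidate: from [e1 y1] back to [e1 (p1 t)], across [sigma t], and on to [e2 y2]. *)
  pose h := (fhom e2 b \; sigma t) \; ginv (fhom e1 a); exists h.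
  have := sE h; case: (s h) => t' [a' b'] /= E.
  have [|k [k1 k2]] := p_full t' t (ginv a \; a') (ginv b \; b').
    apply: (gcomp_injl (g := fhom e2 b)).
    rewrite !fhom_comp !fhom_inv !gcompA ginvr gidl E /h.
    by rewrite -!gcompA.
  split; unshelve refine (exist _ k _).
  by rewrite /= k1 k2 !gcompVK.
Qed.

(** * The Segal property of the bar construction *)

Lemma hbij_eq (X : grpd) (x y : fam X) (h k : fam_hom x y) :
  h = k -> hbij h =1 hbij k.
Proof. by move=> ->. Qed.

Lemma hval_eq (X : grpd) (x y : fam X) (h k : fam_hom x y) :
  h = k -> forall i (e : y (hbij h i) = y (hbij k i)),
  eq_hom e \; hval h i = hval k i.
Proof. by move=> hk i e; subst k; rewrite eq_hom_refl gidl. Qed.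

(** Morphisms of a discrete groupoid are proofs of equality, hence unique; equations in [D R 0] thus
    reduce to bijections. *)
Lemma S_discrete_hom_eq (I : Type) (x y : S_grpd (gdiscrete I))
  (h k : fam_hom x y) : hbij h =1 hbij k -> h = k.
Proof.
move=> e; apply: fam_hom_eq => // i ei.
exact: (@Prop_irrelevance (_ = _ :> I)).
Qed.

Lemma eq_hom_comp (X : grpd) (x y z : X) (e : x = y) (e' : y = z) :
  eq_hom e' \; eq_hom e = eq_hom (etrans e e').
Proof. exact: eq_hom_trans. Qed.

(** The simplicial identity [d_0 d_2 = d_1 d_0]. On objects it holds by conversion, which makes this
    equation well typed. *)
Lemma face_swap (R : operad) (t t' : D R 2) (k : ghom t t') :
  fhom (face R 0 0) (fhom (face R 1 2) k) =
  fhom (face R 0 1) (fhom (face R 1 0) k) :> fam_hom _ _.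
Proof. exact: S_discrete_hom_eq. Qed.

(** The component of [m] at the flat index of [p], transported to index pairs. The target [p'] is
    free up to the proof [e], so that it can be matched with [fam2_map h p]. *)
Definition concat_at (X : grpd) (x y : fam (S_grpd X))
    (m : fam_hom (concat x) (concat y)) p p'
    (e : tagnat.sig (hbij m (tagnat.rank p)) = p') :
    ghom (@fam2 X x p) (@fam2 X y p') :=
  eq_hom (f_equal (@fam2 X y) e) \;
    (hval m (tagnat.rank p) \;
     eq_hom (f_equal (@fam2 X x) (esym (tagnat.rankK p)))).

Lemma concat_at_eq (X : grpd) (x y : fam (S_grpd X))
    (m : fam_hom (concat x) (concat y)) p p' p''
    (e : tagnat.sig (hbij m (tagnat.rank p)) = p')
    (e' : tagnat.sig (hbij m (tagnat.rank p)) = p'')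
    (e'' : @fam2 X y p' = @fam2 X y p'') :
  eq_hom e'' \; concat_at e = concat_at e'.
Proof.
by rewrite /concat_at gcompA; congr (_ \; _); exact: eq_hom_trans.
Qed.

(** The transports cancel by naturality ([eq_hom_nat]), so the components of [h] can be recovered
    from its concatenation. *)
Lemma concat_hom_at (X : grpd) (x y : fam (S_grpd X)) (h : fam_hom x y)
    (m : fam_hom (concat x) (concat y)) p
    (e : tagnat.sig (hbij m (tagnat.rank p)) = fam2_map h p) :
  concat_hom h = m -> hval (hval h (tag p)) (tagged p) = concat_at e.
Proof.
move=> hm; subst m; rewrite /concat_at /=.
pose P r := @eq_hom_nat _ X (@fam2 X x) (fun r => fam2 (fam2_map h r))
  (fun r => hval (hval h (tag r)) (tagged r)) _ _ (esym (tagnat.rankK r)).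
rewrite -[(_ \; hval _ _) \; _]gcompA (P p (f_equal (@fam2 X x) _)
  (f_equal (fun r => fam2 (fam2_map h r)) (esym (tagnat.rankK p)))).
by rewrite !gcompA !eq_hom_comp eq_hom_refl gidl.
Qed.

Lemma concat_hom_eq (X : grpd) (x y : fam (S_grpd X)) (h : fam_hom x y)
    (m : fam_hom (concat x) (concat y))
    (e : forall p, tagnat.sig (hbij m (tagnat.rank p)) = fam2_map h p) :
  (forall p, hval (hval h (tag p)) (tagged p) = concat_at (e p)) ->
  concat_hom h = m.
Proof.
move=> hE; have e' q : hbij (concat_hom h) q = hbij m q.
  rewrite -[q in RHS]tagnat.sigK -[RHS]tagnat.sigK.
  by rewrite e.
apply: fam_hom_eq => // q ei /=; rewrite hE /concat_at.
have E := tagnat.sigK q.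
rewrite (@eq_hom_nat _ X (fun q => concat x q)
   (fun q => concat y (hbij m q)) (hval m) _ _ (esym E)
   _ (f_equal (fun q => concat y (hbij m q)) (esym E))).
by rewrite !gcompA !eq_hom_comp eq_hom_refl gidl.
Qed.

(** A morphism of [D R 2] is assembled from two sources: [n] gives the outer and inner permutations
    and their compatibility with the root operations, [m] gives the isomorphisms of the grafted
    operations. The hypothesis says that [m] permutes these as [n] prescribes. *)
Lemma segal_full (R : operad) (t t' : D R 2)
    (m : ghom (face R 1 2 t) (face R 1 2 t'))
    (n : ghom (face R 1 0 t) (face R 1 0 t')) :
  fhom (face R 0 0) m = fhom (face R 0 1) n :> fam_hom _ _ ->
  exists k : ghom t t', fhom (face R 1 2) k = m /\ fhom (face R 1 0) k = n.
Proof.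
move=> mn.
pose N p := fam2_map (fhom (S_map (phi (A_over R))) n) p.
have mE q : hbij m q = tagnat.rank (N (tagnat.sig q)).
  exact: (hbij_eq mn q).
have NE p : tagnat.sig (hbij m (tagnat.rank p)) = N p.
  by rewrite mE !tagnat.rankK.
pose k : @fam_hom (C R 2) t t' := @FamHom (C R 2) t t' (hbij n)
  (fun i => exist _ (@FamHom (C R 1) (tfam (t i)) (tfam (t' (hbij n i)))
                      (hbij (sval (hval n i)))
                      (fun j => @concat_at (C R 1)
                         (S_map (phi (R_pow R 1)) t)
                         (S_map (phi (R_pow R 1)) t') m _ _ (NE (existT _ i j))))
                    (svalP (hval n i))).
exists k; split.
  by apply: (@concat_hom_eq (C R 1)) => -[i j].
apply: (@fam_hom_eq (C R 1)) => [//|i ei]; rewrite eq_hom_refl gidl.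
by apply: sig_hom_eq; exact: S_discrete_hom_eq.
Qed.

(** The permutations are visible after [d_0], the isomorphisms of grafted operations after [d_2]. *)
Lemma segal_faithful (R : operad) (t t' : D R 2) (k k' : ghom t t') :
  fhom (face R 1 2) k = fhom (face R 1 2) k' ->
  fhom (face R 1 0) k = fhom (face R 1 0) k' -> k = k'.
Proof.
move=> k2 k0; case: k k' k2 k0 => [s u] [s' u'] k2 k0.
have ss' : s = s' by apply: Defs.bij_eq; exact: (hbij_eq k0).
subst s'; congr FamHom; apply: functional_extensionality_dep => i.
have u0 : sval (fhom (R_map (alpha R)) (u i)) = sval (fhom (R_map (alpha R)) (u' i)).
  have := @hval_eq (C R 1) (face R 1 0 t) (face R 1 0 t') _ _ k0 i erefl.
  by rewrite gidl => H; exact: (congr1 sval H).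
apply: sig_hom_eq; apply: (@fam_hom_eq (C R 1)) => [|j ej]; first exact: (hbij_eq u0).
pose h : @fam_hom (S_grpd (C R 1)) (S_map (phi (R_pow R 1)) t)
  (S_map (phi (R_pow R 1)) t') := fhom (S_map (phi (R_pow R 1))) (FamHom u).
pose h' : @fam_hom (S_grpd (C R 1)) (S_map (phi (R_pow R 1)) t)
  (S_map (phi (R_pow R 1)) t') := fhom (S_map (phi (R_pow R 1))) (FamHom u').
pose p : {i : 'I_(flen t) & 'I_(flen (tfam (t i)))} := existT _ i j.
(* Both components at [(i, j)] are read off from the one morphism [concat_hom h'], with targets that
   agree along [ej]. *)
have e : tagnat.sig (hbij (concat_hom h') (tagnat.rank p)) = fam2_map h p.
  have -> : concat_hom h' = concat_hom h by [].
  by rewrite /= !tagnat.rankK.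
have e' : tagnat.sig (hbij (concat_hom h') (tagnat.rank p)) = fam2_map h' p.
  by rewrite /= !tagnat.rankK.
have E := @concat_hom_at (C R 1) _ _ h (concat_hom h') p e k2.
have E' := @concat_hom_at (C R 1) _ _ h' (concat_hom h') p e' erefl.
have E'' := @concat_at_eq (C R 1) _ _ (concat_hom h') p _ _ e e' ej.
exact: etrans (congr1 (gcomp (eq_hom ej)) E) (etrans E'' (esym E')).
Qed.

(** * Grafting along a matching of colours *)

Definition segal_map (R : operad) : gfunctor (D R 2) (gprod (D R 1) (D R 1)) :=
  functor_pair (face R 1 2) (face R 1 0).

Lemma segal_glue_subproof (R : operad) (y1 y2 : D R 1)
    (h : ghom (face R 0 0 y1) (face R 0 1 y2)) i j :
  out (troot (y1 (binv (hbij h)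
    (@tagnat.rank _ (fun i => flen (tfam (y2 i))) (existT _ i j))))) =
  inp (troot (y2 i)) j.
Proof.
have H q : out (troot (y1 q)) =
    tfam (y2 (tag (tagnat.sig (hbij h q)))) (tagged (tagnat.sig (hbij h q))).
  exact: (hval h q).
rewrite H binvK tagnat.rankK /=; exact: (tcol (y2 i) j).
Qed.

(** At input [j] of [y2 i] stands the operation of [y1] that [h] matches with this input; the
    colours fit because the components of [h] are equalities of colours. *)
Definition segal_glue (R : operad) (y1 y2 : D R 1)
    (h : ghom (face R 0 0 y1) (face R 0 1 y2)) : D R 2 :=
  @Fam (C R 2) (flen y2) (fun i => @Tree R (R_over (A_over R))
    (@Fam (C R 1) (flen (tfam (y2 i))) (fun j => y1 (binv (hbij h)
      (@tagnat.rank _ (fun i => flen (tfam (y2 i))) (existT _ i j)))))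
    (troot (y2 i)) (@segal_glue_subproof R y1 y2 h i)).

Lemma segal_glue_top_subproof (R : operad) (y1 y2 : D R 1)
    (h : ghom (face R 0 0 y1) (face R 0 1 y2)) q :
  face R 1 2 (segal_glue h) q = y1 (binv (hbij h) q).
Proof.
by rewrite -[q in RHS]tagnat.sigK -[tagnat.sig q in RHS]taggedK.
Qed.

Definition segal_glue_top (R : operad) (y1 y2 : D R 1)
    (h : ghom (face R 0 0 y1) (face R 0 1 y2)) :
    ghom (face R 1 2 (segal_glue h)) y1 :=
  @FamHom (C R 1) (face R 1 2 (segal_glue h)) y1 (bij_inv (hbij h))
    (fun q => eq_hom (segal_glue_top_subproof q)).

(** The root operations are unchanged; only their input colours are recorded differently, as output
    colours of operations of [y1]. *)
Definition segal_glue_root (R : operad) (y1 y2 : D R 1)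
    (h : ghom (face R 0 0 y1) (face R 0 1 y2)) :
    ghom (face R 1 0 (segal_glue h)) y2 :=
  @FamHom (C R 1) (face R 1 0 (segal_glue h)) y2 (bij_id (flen y2))
    (fun i => exist _ (@FamHom (C R 0) (tfam (face R 1 0 (segal_glue h) i)) (tfam (y2 i))
      (bij_id _)
      (fun j => etrans (@segal_glue_subproof R y1 y2 h i j)
        (esym (tcol (y2 i) j)))) (act_id _)).

Definition segal_section (R : operad) (y1 y2 : D R 1)
    (h : ghom (face R 0 0 y1) (face R 0 1 y2)) :
    hfib (segal_map R) (y1, y2) :=
  @fib_pt _ _ (segal_map R) (y1, y2) (segal_glue h) (segal_glue_top h, segal_glue_root h).

Lemma transversal_segal (R : operad) (y1 y2 : D R 1) :
  pi0_transversal (@segal_section R y1 y2).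
Proof.
(* The square of faces commutes strictly, so the comparison [sigma] is an identity. *)
apply: (@transversal_pullback (D R 2) (D R 1) (D R 1) (D R 0)
  (face R 1 2) (face R 1 0) (face R 0 0) (face R 0 1)
  (fun t => gid (face R 0 0 (face R 1 2 t))) y1 y2 (@segal_section R y1 y2)).
- move=> t t' k.
  refine (etrans (@gidr (D R 0) _ _ _) _).
  refine (etrans (esym (face_swap k)) _).
  exact: esym (@gidl (D R 0) _ _ _).
- by move=> t t' k k'; exact: segal_faithful.
- move=> t t' m n mn; apply: segal_full.
  exact: esym (etrans (esym (gidr _)) (etrans mn (gidl _))).
(* Only bijections matter here: [h] undoes its inverse, and [bij_sum] of identities is the
   identity. *)
- move=> h; apply: S_discrete_hom_eq => q /=.
  rewrite binvK -[RHS]tagnat.sigK.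
  by case: (tagnat.sig _).
Qed.

(** * Local finiteness and the coordinates of both sides *)

(** The only permutation of ['I_1] is the identity, so a morphism of singletons is its one
    component. *)
Lemma full_faithful_S_unit (X : grpd) : full_faithful (S_unit X).
Proof.
move=> x y g; exists (hval g ord0); last by move=> f' <-.
apply: fam_hom_eq => [i|i ei /=]; first by rewrite !ord1.
by rewrite eq_hom_refl gidl; case: i ei => -[|//] i _; congr (hval g _); apply: val_inj.
Qed.

Lemma S_unit_image (X : grpd) (y : S_grpd X) :
  flen y = 1%N -> exists b, S_unit X b = y.
Proof.
case: y => n y /= n1; subst n; exists (y ord0); congr Fam.
by apply/funext => i; rewrite (ord1 i).
Qed.

Lemma flen_hom (X : grpd) (x y : S_grpd X) : ghom x y -> flen x = flen y.
Proof.
move=> f; rewrite -[LHS]card_ord -[RHS]card_ord; apply: bij_eq_card (hbij f) _.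
by exists (binv (hbij f)); [exact: bfunK | exact: binvK].
Qed.

(** An automorphism is coded by a finite function giving, at each [i], the image index and a code
    for the component. The tag [(i, hbij h i)] is there because the Hom-set of the component depends
    on it. *)
Lemma locally_finite_S (X : grpd) : locally_finite X -> locally_finite (S_grpd X).
Proof.
move=> finX x.
have code i : {F : finType & {f : ghom (x i.1) (x i.2) -> F | injective f}}.
  have /cid[F /cid[f /bij_inj f_inj]] :=
    finite_finType_bij (locally_finite_hom (x i.1) (x i.2) finX).
  by exists F, f.
pose F i := tag (code i).
pose f (h : fam_hom x x) := [ffun i => existT F (i, hbij h i)
  (sval (tagged (code (i, hbij h i))) (hval h i))].
apply: (@finite_inj _ _ f); last exact: finite_finset.
move=> h k fhk; apply: fam_hom_eq => [i|i ei].
  by move/ffunP/(_ i): fhk; rewrite !ffunE => /(congr1 (fun p => (tag p).2)).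
move/ffunP/(_ i): fhk; rewrite !ffunE.
move: (hval h i) (hval k i) ei; move: (hbij h i) (hbij k i) => j j' u v ei e.
have jj' := congr1 (fun p => (tag p).2) e; rewrite /= in jj'; subst j'.
rewrite eq_hom_refl gidl; apply: (svalP (tagged (code (i, j)))).
by move/eqP: e; rewrite eq_Tagged => /eqP.
Qed.

Lemma locally_finite_R (R : operad) (X : Defs.over (colour R)) :
  locally_finite X -> locally_finite (R_over X).
Proof.
move=> finX x.
have finS := locally_finite_S finX (tfam x).
by apply: finite_inj finS; exact: sig_hom_eq.
Qed.

Lemma locally_finite_discrete (I : Type) : locally_finite (gdiscrete I).
Proof.
move=> i; apply: (@finite_inj _ unit (fun=> tt)) => [e e' _|].
  exact: (@Prop_irrelevance (_ = _ :> I)).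
exact: finite_finset.
Qed.


Lemma locally_finite_D (R : operad) n : locally_finite (D R n).
Proof.
apply: locally_finite_S; elim: n => [|n IHn]; first exact: locally_finite_discrete.
exact: locally_finite_R.
Qed.

(** One chosen isomorphism from each [k t] in the class [c] to the representative turns its Hom-set
    into a copy of the automorphism group. *)
Lemma sig_hom_bij (T : Type) (X : grpd) (k : T -> X) (c : pi0 X) :
  exists f : {t : T & ghom (k t) (representative c)} ->
    {t | iso_class (k t) = c} * ghom (representative c) (representative c),
  bijective f.
Proof.
have iso (q : {t | iso_class (k t) = c}) : ghom (k (sval q)) (representative c).
  apply: (@sval _ (fun=> True)); apply: cid.
  have /iso_classP[f] : iso_class (k (sval q)) = iso_class (representative c).
    by rewrite (svalP q) representativeK.
  by exists f.
have cls t : ghom (k t) (representative c) -> iso_class (k t) = c.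
  by move=> u; rewrite -[RHS]representativeK; apply/iso_classP.
pose q (a : {t : T & ghom (k t) (representative c)}) : {t | iso_class (k t) = c} :=
  exist _ _ (cls _ (tagged a)).
exists (fun a => (q a, tagged a \; ginv (iso (q a)))).
exists (fun b => existT _ (sval b.1) (b.2 \; iso b.1)) => [[t u]|[[t tc] u]] /=.
  by rewrite -gcompA ginvl gidr.
by rewrite /q /= (Prop_irrelevance (cls _ _) tc) -gcompA ginvr gidr.
Qed.

Lemma finite_sig_hom (T : Type) (X : grpd) (k : T -> X) c :
  locally_finite X -> finite_set [set: T] ->
  finite_set [set: {t : T & ghom (k t) (representative c)}].
Proof.
move=> finX finT; have [f /bij_inj f_inj] := sig_hom_bij k c.
apply: finite_inj f_inj _; rewrite -setXTT; apply: finite_setX => //.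
by apply: finite_inj finT; exact: sig_hom_eq.
Qed.

Lemma ncard_sig_hom (T : Type) (X : grpd) (k : T -> X) c :
  locally_finite X -> finite_set [set: T] ->
  (ncard {t : T & ghom (k t) (representative c)})%:R =
  (ncard {t | iso_class (k t) = c})%:R * aut_card (representative c).
Proof.
move=> finX finT; have [f f_bij] := sig_hom_bij k c.
have finF : finite_set [set: {t | iso_class (k t) = c}].
  by apply: finite_inj finT; exact: sig_hom_eq.
rewrite -natrM -ncard_prod // (ncard_bij _ f_bij) //.
by rewrite -setXTT; apply: finite_setX.
Qed.

Lemma hcard_S_unit_fibre (X Z : grpd) (P : gfunctor (S_grpd X) Z) w y :
  locally_finite Z ->
  hcard (hfib (functor_comp (S_unit X) (hfib_proj (functor_comp P (S_unit X)) w)) y)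
  = if flen y == 1%N then (ncard (ghom (P y) w))%:R else 0.
Proof.
move=> finZ; case: eqP => [/S_unit_image[b <-]|y1].
  rewrite (hcard_transversal (transversal_ff _ _ (gid _) (@full_faithful_S_unit X))) //.
  exact: locally_finite_hom.
(* A point of the fibre would be an isomorphism from a family of length 1 to [y]. *)
apply: hcard_empty => -[v /flen_hom /= e]; exact: y1.
Qed.

(** * Coordinates of the Green functions and of the terms of both sums *)

Lemma greenE (R : operad) c :
  green R c = (flen (representative c) == 1%N)%:R / aut_card (representative c).
Proof.
rewrite /green /map_card; congr (_ / _); set y := representative c.
case: eqP => [/S_unit_image[b <-]|y1].
  rewrite (hcard_transversal (transversal_unit_ff (gid _) (@full_faithful_S_unit _))).
    by rewrite (@ncard_eq1 _ tt) // => -[].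
  exact: finite_finset.
apply: hcard_empty => -[v /flen_hom /= e]; exact: y1.
Qed.

Lemma green_inE (R : operad) w c : green_in R w c =
  (if flen (representative c) == 1%N
   then (ncard (ghom (face R 0 1 (representative c)) w))%:R else 0)
  / aut_card (representative c).
Proof.
by rewrite /green_in /map_card hcard_S_unit_fibre //; exact: locally_finite_D.
Qed.

Lemma green_outE (R : operad) w c : green_out R w c =
  (ncard (ghom (face R 0 0 (representative c)) w))%:R / aut_card (representative c).
Proof.
rewrite /green_out /map_card; congr (_ / _); set y := representative c.
rewrite -[hfib_proj _ _]functor_comp_idl.
rewrite (hcard_transversal (transversal_ff _ _
  (gid y : ghom (functor_id _ y) y) (@full_faithful_id _))) //.
by apply: locally_finite_hom; exact: locally_finite_D.
Qed.

(** By [transversal_segal] and [transversal_span] the fibre is the set of pairs of a matching [h]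
    and a morphism from its composite to the representative of [c]. Counting these yields a factor
    [aut_card], which cancels the denominator of the coordinate of [G] at [c]. *)
Lemma comult_termsE (R : operad) c z :
  comult_terms R (green R) c z =
  (flen (representative z).2 == 1%N)%:R / aut_card (representative z) *
  (ncard {h : ghom (face R 0 0 (representative z).1)
                   (face R 0 1 (representative z).2) |
          iso_class (face R 1 1 (segal_glue h)) = c})%:R.
Proof.
rewrite /comult_terms /span_terms /scale /Defs.span_basis /map_card greenE.
case: (representative z) => y1 y2; rewrite /snd /fst.
have fin1 := @locally_finite_D R 1.
have finT : finite_set [set: ghom (face R 0 0 y1) (face R 0 1 y2)].
  by apply: locally_finite_hom; exact: locally_finite_D.
have N := hcard_transversal
  (transversal_span (face R 1 1) (representative c) (transversal_segal y1 y2))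
  (finite_sig_hom (fun h => face R 1 1 (segal_glue h)) c fin1 finT).
have M := ncard_sig_hom (fun h => face R 1 1 (segal_glue h)) c fin1 finT.
rewrite [hcard _](etrans N M).
case: (pselect (exists h : ghom (face R 0 0 y1) (face R 0 1 y2),
  iso_class (face R 1 1 (segal_glue h)) = c)); last first.
  move=> no_h; rewrite (@ncard_eq0 {h | _}) ?(mul0r, mulr0) // => -[h hc].
  by apply: no_h; exists h.
(* [d_1] composes within each entry and preserves the length, so the length condition on [c] passes
   to [y2]. *)
case=> h hc; have -> : flen (representative c) = flen y2.
  have /iso_classP[f] :
      iso_class (face R 1 1 (segal_glue h)) = iso_class (representative c).
    by rewrite representativeK.
  by rewrite -(flen_hom f).
have := aut_card_neq0 (representative c) fin1.
move: (aut_card (representative c)) => a a0.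
by rewrite -!mulrA; congr (_ * _); rewrite mulrCA mulKf // mulrC.
Qed.


Lemma green_termE (R : operad) (c : pi0 (D R 0)) z :
  tensor (green_out R (representative c))
    (scale (aut_card (representative c))^-1 (green_in R (representative c))) z =
  (flen (representative z).2 == 1%N)%:R / aut_card (representative z) *
  (if c == iso_class (face R 0 0 (representative z).1)
   then (ncard (ghom (face R 0 0 (representative z).1)
                     (face R 0 1 (representative z).2)))%:R else 0).
Proof.
have fin0 := @locally_finite_D R 0; have fin1 := @locally_finite_D R 1.
rewrite /tensor /scale green_outE green_inE aut_card_prod //.
case: (representative z) => y1 y2; rewrite /fst /snd.
(* [tensor] evaluates at representatives of the classes of [y1] and [y2], which are isomorphic to
   them but need not be equal. *)
set y1' := representative _; set y2' := representative (iso_class y2).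
have [f1] : inhabited (ghom y1' y1) by apply/iso_classP; exact: representativeK.
have [f2] : inhabited (ghom y2' y2) by apply/iso_classP; exact: representativeK.
rewrite (aut_card_iso fin1 f1) (aut_card_iso fin1 f2) (flen_hom f2).
set w := representative c.
have g1 := fhom (face R 0 0) f1; have g2 := fhom (face R 0 1) f2.
rewrite (ncard_hom_iso fin0 g1 (gid w)) (ncard_hom_iso fin0 g2 (gid w)).
have [cE|cN] := eqVneq c _; last first.
  rewrite ncard_eq0 ?(mul0r, mulr0) // => f; case/eqP: cN.
  by rewrite -[c]representativeK; apply/esym/iso_classP.
have [f] : inhabited (ghom (face R 0 0 y1) w).
  by apply/iso_classP; rewrite representativeK cE.
(* Reverse the arrows, then replace [w] by the isomorphic [d_0 y1]. *)
have -> : ncard (ghom (face R 0 1 y2) w) =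
    ncard (ghom (face R 0 0 y1) (face R 0 1 y2)).
  by rewrite ncard_hom_sym // (ncard_hom_iso fin0 (ginv f) (gid _)).
rewrite (ncard_hom_iso fin0 f (gid w)) -/(aut_card w).
have := aut_card_neq0 w fin0.
case: (flen y2 == 1%N); last by rewrite !(mul0r, mulr0).
move: (aut_card w) (aut_card y1) (aut_card y2) (ncard _)%:R => a a1 a2 n a0.
by rewrite mul1r invfM [a / a1]mulrC -!mulrA mulVKf // [n / a2]mulrC.
Qed.

Theorem mainTheorem1 (R : operad) (HR : operad_locally_finite R) :
  let green_terms (c : pi0 (D R 0)) :=
    let w := representative c in
    tensor (green_out R w) (scale (aut_card w)^-1 (green_in R w)) in
  [/\ summable (comult_terms R (green R)),
      summable green_terms &
      comult R (green R) = infinite_sum green_terms].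
Proof.
move=> green_terms; have fin_hom := @locally_finite_hom _ _ _ (@locally_finite_D R 0).
split=> [z|z|].
(* Only the classes of composites [d_1 (segal_glue h)] contribute, and there are finitely many
   [h]. *)
- pose k (h : ghom (face R 0 0 (representative z).1)
                   (face R 0 1 (representative z).2)) :=
    iso_class (face R 1 1 (segal_glue h)).
  apply: sub_finite_set (finite_fibres_support k (fin_hom _ _)) => c.
  by rewrite /mkset comult_termsE mulf_eq0 negb_or => /andP[].
- pose w := iso_class (face R 0 0 (representative z).1).
  apply: sub_finite_set (finite_set1 w) => c.
  rewrite /mkset /green_terms green_termE -/w.
  by case: (c =P w) => // _; rewrite mulr0 eqxx.
apply/funext => z; rewrite /comult /span_card /infinite_sum.
under eq_fsbigr do rewrite -/(comult_terms R (green R) _ _) comult_termsE.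
under [RHS]eq_fsbigr do rewrite /green_terms green_termE.
(* Both sums share the prefactor. On the left the matchings [h], sorted by the class of their
   composite, add up to all of them; on the right a single class remains. *)
rewrite -!mulr_fsumr sum_ncard_fibres //; congr (_ * _).
rewrite (fsbigTE [fset iso_class (face R 0 0 (representative z).1)]%fset) => [|c].
  by rewrite big_seq_fset1 eqxx.
by rewrite inE => /negbTE ->.
Qed.
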